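(* Let $\alpha$ be irrational and let $R_\alpha:\mathbb{S}^1\to\mathbb{S}^1$, $R_\alpha(x)=x+\alpha \pmod{\mathbb{Z}}$. Let $\overline{\delta}>0$ and let $\{T_\delta\}_{0\le\delta\le\overline{\delta}}$ be a family of Borel measurable maps $T_\delta:\mathbb{S}^1\to\mathbb{S}^1$ such that $$\sup_{x\in\mathbb{S}^1}|R_\alpha(x)-T_\delta(x)|\le\delta .$$ Suppose that, for each $\delta$, $\mu_\delta$ is an invariant Borel probability measure of $T_\delta$. Then $$\lim_{\delta\to0}\|m-\mu_\delta\|_W=0 .$$
   Context: $\mathbb{S}^1=\mathbb{R}/\mathbb{Z}$, $|x-y|$ denotes the circle distance between $x,y\in\mathbb{S}^1$ (distance from $x-y$ to the nearest integer), and $m$ is Lebesgue (probability) measure on $\mathbb{S}^1$. A measure $\mu$ is invariant for a Borel map $T$ if $\mu(T^{-1}(A))=\mu(A)$ for all Borel sets $A$. For a finite signed Borel measure $\mu$ on $\mathbb{S}^1$, $$\|\mu\|_W:=\sup\left\{\left|\int_{\mathbb{S}^1} g\,d\mu\right| : g:\mathbb{S}^1\to\mathbb{R},\ \mathrm{Lip}(g)\le1,\ \|g\|_\infty\le1\right\},$$ where $\mathrm{Lip}(g)$ is the best Lipschitz constant of $g$. *)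

(* Defs.v *)
(* MathComp / MathComp-Analysis, over an arbitrary [R : realType]. *)
From HB Require Import structures.
From mathcomp Require Import all_boot all_order all_algebra.
From mathcomp Require Import generic_quotient ring_quotient.
From mathcomp Require Import all_classical all_reals all_analysis.
From mathcomp Require Import ring.

Set Implicit Arguments.
Unset Strict Implicit.
Unset Printing Implicit Defensive.

Import Order.TTheory GRing.Theory Num.Theory.
Import numFieldNormedType.Exports.

Local Open Scope classical_set_scope.
Local Open Scope ring_scope.
Local Open Scope quotient_scope.

(* R/Z as a quotient group with the quotient topology, equipped with the
   sigma-algebra generated by the open sets. *)
Definition integer_subgroup (R : realType) : zmodClosed R :=
  GRing.ZmodClosed.clone R (@Num.int_num_subdef R) _.

Definition circle_group (R : realType) : Type :=
  Quotient.quot (integer_subgroup R).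
HB.instance Definition _ (R : realType) :=
  GRing.Zmodule.on (circle_group R).
HB.instance Definition _ (R : realType) :=
  EqQuotient.on (circle_group R).

Definition circle (R : realType) : Type :=
  quotient_topology (circle_group R).
HB.instance Definition _ (R : realType) := Topological.on (circle R).
HB.instance Definition _ (R : realType) := Pointed.on (circle R).
HB.instance Definition _ (R : realType) := Quotient.on (circle R).
HB.instance Definition _ (R : realType) :=
  GRing.Zmodule.copy (circle R) (circle_group R).
HB.instance Definition _ (R : realType) :=
  @isMeasurable.Build (sigma_display (@open (circle R))) (circle R)
    <<s @open (circle R) >> (@sigma_algebra0 _ setT (@open (circle R)))
    (@sigma_algebraC (circle R) (@open (circle R)))
    (@sigma_algebra_bigcup _ setT (@open (circle R))).

Section circle.
Variable R : realType.

Definition to_circle (r : R) : circle R := \pi_(circle R) r.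

Lemma to_circleD (r s : R) : to_circle (r + s) = to_circle r + to_circle s.
Proof. exact: (raddfD (\pi_(circle_group R))). Qed.

Lemma to_circleB (r s : R) : to_circle (r - s) = to_circle r - to_circle s.
Proof. exact: (raddfB (\pi_(circle_group R))). Qed.

Lemma eq_to_circle (r s : R) :
  to_circle r = to_circle s <-> r - s \is a Num.int.
Proof.
have E := Quotient.idealrBE (integer_subgroup R) r s.
rewrite -[r - s \is a _]/(r - s \in integer_subgroup R) E.
by split=> [rs|/eqP//]; apply/eqP.
Qed.

Lemma measurable_to_circle :
  measurable_fun [set: measurableTypeR R] (to_circle : measurableTypeR R -> _).
Proof.
apply: (@measurability _ _ _ _ _ _ (@open (circle R))) => //.
move=> _ [U oU <-]; rewrite setTI.
exact: measurable_realfun.open_measurable.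
Qed.

Definition nearest_int_dist (r : R) : R :=
  inf (range (fun k : int => `|r - k%:~R|)).

Definition circle_dist (x y : circle R) : R := nearest_int_dist (repr (x - y)).

Lemma circle_distE (r s : R) :
  circle_dist (to_circle r) (to_circle s) = nearest_int_dist (r - s).
Proof.
rewrite /circle_dist -to_circleB.
have /intrP[k rE] : repr (to_circle (r - s)) - (r - s) \is a Num.int.
  by apply/eq_to_circle; rewrite /to_circle reprK.
rewrite /nearest_int_dist; congr inf; apply/seteqP; split => _ [j _ <-] /=.
  by exists (j - k) => //; rewrite intrB -rE; congr `| _ |; ring.
by exists (j + k) => //; rewrite intrD -rE; congr `| _ |; ring.
Qed.

Definition rotation (alpha : R) (x : circle R) : circle R :=
  x + to_circle alpha.

Definition circle_lebesgue : set (circle R) -> \bar R :=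
  pushforward
    (mrestr (@lebesgue_measure R) (measurable_itv `[0%R, 1%R[))
    (to_circle : measurableTypeR R -> circle R).

Let circle_lebesgue0 : circle_lebesgue set0 = 0%E.
Proof.
by rewrite /circle_lebesgue /pushforward preimage_set0 /mrestr set0I measure0.
Qed.

Let circle_lebesgue_ge0 A : (0 <= circle_lebesgue A)%E.
Proof. by rewrite /circle_lebesgue /pushforward /mrestr measure_ge0. Qed.

Let circle_lebesgue_sigma_additive : semi_sigma_additive circle_lebesgue.
Proof.
apply: (@measure_semi_sigma_additive _ _ _ (pushforward _ _)).
exact: measurable_to_circle.
Qed.

HB.instance Definition _ := isMeasure.Build _ _ _ circle_lebesgue
  circle_lebesgue0 circle_lebesgue_ge0 circle_lebesgue_sigma_additive.

Let circle_lebesgue_setT : circle_lebesgue [set: circle R] = 1%E.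
Proof.
rewrite /circle_lebesgue /pushforward preimage_setT /mrestr setTI.
by rewrite lebesgue_measure_itv/= lte_fin ltr01 oppr0 adde0.
Qed.

HB.instance Definition _ := Measure_isProbability.Build _ _ _ circle_lebesgue
  circle_lebesgue_setT.

Local Open Scope ereal_scope.

(* The best Lipschitz constant, [+oo] if there is none. *)
Definition lip (g : circle R -> R) : \bar R :=
  ereal_inf [set L%:E | L in [set L : R | (0 <= L)%R /\
    forall x y, (`|g x - g y| <= L * circle_dist x y)%R]].

Definition supnorm (g : circle R -> R) : \bar R :=
  ereal_sup (range (fun x => `|g x|%:E)).

End circle.

Local Open Scope ereal_scope.

Definition invariant_measure d (X : measurableType d) (R : realType)
    (T : X -> X) (mu : set X -> \bar R) : Prop :=
  forall A, measurable A -> mu (T @^-1` A) = mu A.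

Section charge_integral.
Context d (X : measurableType d) (R : realType).
Variable nu : {charge set X -> \bar R}.

(* By uniqueness of the Jordan decomposition, the integral does not depend on
   the Hahn decomposition chosen here. *)
Let PN := cid (Hahn_decomposition nu).
Let nuPN : hahn_decomposition nu (sval PN) (sval (cid (svalP PN))) :=
  svalP (cid (svalP PN)).

Definition charge_integral (g : X -> R) : \bar R :=
  \int[jordan_pos nuPN]_x (g x)%:E - \int[jordan_neg nuPN]_x (g x)%:E.

End charge_integral.

Definition wnorm (R : realType) (nu : {charge set (circle R) -> \bar R}) :
    \bar R :=
  ereal_sup [set `|charge_integral nu g|
            | g in [set g | lip g <= 1 /\ supnorm g <= 1]].

Definition measure_diff d (X : measurableType d) (R : realType)
    (mu nu : {finite_measure set X -> \bar R}) : {charge set X -> \bar R} :=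
  cadd (charge_of_finite_measure mu) (copp (charge_of_finite_measure nu)).

(* Main.v *)
(* For a 1-Lipschitz [g], put [phi t = \int g (x + t) dmu_d]. Since [T_d] is
   [d]-close to the rotation and preserves [mu_d], [phi (t + alpha)] is within
   [d] of [phi t]; as the multiples of [alpha] are dense mod 1, for any [eps]
   and any finite set of [t]'s there is [N], independent of [g] and [d], with
   [|phi t - phi 0| <= eps + N d]. Averaging over [t = i/K], [i < K], gives
   the integral against [mu_d] of a Riemann sum, which is within [1/K] of
   [\int g dm] everywhere on the circle. Hence
   [|\int g dm - \int g dmu_d| <= 1/K + eps + N d], uniformly in [g]. *)
Require Import Defs.
From mathcomp Require Import all_boot all_order all_algebra.
From mathcomp Require Import all_classical all_reals all_analysis.
From mathcomp Require Import measurable_realfun.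
From mathcomp Require Import ring lra.

Import Order.TTheory GRing.Theory Num.Theory.
Import numFieldNormedType.Exports.

Local Open Scope classical_set_scope.
Local Open Scope ring_scope.

(** * Density modulo 1 of the multiples of an irrational *)

Section irrational_multiples.
Variable R : realType.

(** Pigeonhole: two of the K+1 fractional parts of i alpha, i <= K, fall into the same box of length
    1/K < eps. Their difference has the form q alpha - p, and it is nonzero because alpha is
    irrational. *)
Lemma small_irrational_multiple (alpha eps : R) : irrational alpha -> 0 < eps ->
  exists (q : nat) (p : int), 0 < `|q%:R * alpha - p%:~R| < eps.
Proof.
move=> irr eps0.
have [K K0 Keps] : exists2 K : nat, 0 < K%:R :> R & K%:R^-1 < eps.
  exists (Num.truncn eps^-1).+1; first by rewrite ltr0n.
  by rewrite invf_plt ?posrE ?ltr0n// truncnS_gt.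
pose frac (i : nat) : R := i%:R * alpha - (Num.floor (i%:R * alpha))%:~R.
have frac_itv i : 0 <= frac i < 1.
  by rewrite /frac subr_ge0 floor_le /= ltrBlDl -intrD1 floorD1_gt.
have box i : (Num.truncn (K%:R * frac i) < K)%N.
  have /andP[f0 f1] := frac_itv i.
  rewrite -(ltr_nat R); apply: le_lt_trans (_ : K%:R * frac i < _).
    by rewrite truncn_le// mulr_ge0// ltW.
  by rewrite gtr_pMr.
pose f (i : 'I_K.+1) : 'I_K := Ordinal (box i).
have /injectivePn[i [j ij fij]] : ~~ injectiveb f.
  by apply/negP => /injectiveP/leq_card; rewrite !card_ord ltnn.
wlog ltij : i j ij fij / (i < j)%N.
  move=> H; have : i != j :> nat by [].
  rewrite neq_ltn => /orP[|] ?; first exact: (H i j).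
  by apply: (H j i) => //; rewrite eq_sym.
have fracij : `|frac j - frac i| < K%:R^-1.
  have {}fij : Num.truncn (K%:R * frac i) = Num.truncn (K%:R * frac j).
    by case: fij.
  have /andP[fi0 _] := frac_itv i; have /andP[fj0 _] := frac_itv j.
  have /truncn_itv/andP[i1 i2] : 0 <= K%:R * frac i by rewrite mulr_ge0// ltW.
  have /truncn_itv/andP[j1 j2] : 0 <= K%:R * frac j by rewrite mulr_ge0// ltW.
  rewrite -(ltr_pM2l K0) mulfV ?gt_eqF// -[X in X * _]gtr0_norm// -normrM.
  move: i1 i2 j1 j2; rewrite -fij -!natr1 ltr_norml (mulrBr _ (frac j)) => *.
  by apply/andP; split; lra.
exists (j - i)%N, (Num.floor (j%:R * alpha) - Num.floor (i%:R * alpha)).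
have -> : (j - i)%:R * alpha -
    (Num.floor (j%:R * alpha) - Num.floor (i%:R * alpha))%:~R = frac j - frac i.
  by rewrite /frac natrB ?(ltnW ltij)// intrB; ring.
rewrite (lt_trans fracij Keps) andbT normr_gt0; apply/eqP => frac0.
apply: irr; apply/rationalP.
exists (Num.floor (j%:R * alpha) - Num.floor (i%:R * alpha)), (j - i)%N.
have ji0 : (j - i)%:R != 0 :> R by rewrite pnatr_eq0 subn_eq0 -ltnNge.
apply: (mulIf ji0); rewrite divfK// natrB ?(ltnW ltij)// intrB.
by move: frac0; rewrite /frac => ?; lra.
Qed.

(** Walking in steps of length |q alpha - p| < eps lands within eps of any target ahead. Since n is
    natural, the target is first shifted by an integer so as to lie ahead of the walk. *)
Lemma irrational_multiples_dense (alpha eps t : R) :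
  irrational alpha -> 0 < eps ->
  exists (n : nat) (k : int), `|t - n%:R * alpha - k%:~R| < eps.
Proof.
move=> irr eps0.
have [q [p /andP[th0 theps]]] := small_irrational_multiple _ _ irr eps0.
(* A multiple of q alpha - p is a multiple of alpha up to an integer. *)
suff [n [k nk]] : exists (n : nat) (k : int),
    `|t - n%:R * (q%:R * alpha - p%:~R) - k%:~R| < eps.
  exists (n * q)%N, (k - n%:Z * p); move: nk.
  rewrite intrB intrM natrM; congr (`| _ | < _).
  by rewrite -pmulrn; ring.
have pos (s th : R) : 0 < th < eps ->
    exists (n : nat) (k : int), `|s - n%:R * th - k%:~R| < eps.
  case/andP => thpos thlt.
  (* Adding [k0] makes the target nonnegative, so truncating its quotient by [th] gives n th <= s +
     k0 < (n + 1) th. *)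
  have [k0 s0] : exists k0 : nat, 0 <= s + k0%:R.
    exists `|Num.floor s|%N.
    suff : - `|Num.floor s|%:R <= s by lra.
    apply: le_trans (floor_le s); rewrite pmulrn -mulrNz ler_int.
    by rewrite abszE lerNl ler_normr lexx orbT.
  have /truncn_itv/andP[n1 n2] : 0 <= (s + k0%:R) / th.
    by rewrite divr_ge0// ltW.
  move: (Num.truncn _) n1 n2 => n.
  rewrite ler_pdivlMr// ltr_pdivrMr// -natr1 mulrDl mul1r => n1 n2.
  exists n, (- k0%:Z); rewrite mulrNz opprK -pmulrn ltr_norml.
  by apply/andP; split; lra.
move: th0 theps; set th := _ - _ => th0 theps.
have [thp|thn|th00] := ltgtP 0 th; last by rewrite -th00 normr0 ltxx in th0.
  by apply: pos; rewrite thp /= -(gtr0_norm thp).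
(* A negative step is the positive case reflected through 0. *)
have [|n [k nk]] := pos (- t) (- th).
  by rewrite oppr_gt0 thn /= -(ltr0_norm thn).
exists n, (- k); rewrite -normrN mulrNz; move: nk.
by congr (`| _ | < _); ring.
Qed.

End irrational_multiples.

(** * Integrals of bounded functions, and integrals against a difference of finite measures *)

Lemma Rintegral_dist_cst d (X : measurableType d) (R : realType)
    (mu : {measure set X -> \bar R}) (D : set X) (f : X -> R) (c e : R) :
  measurable D -> (mu D < +oo)%E -> mu.-integrable D (EFin \o f) ->
  (forall x, D x -> `|f x - c| <= e) ->
  `|\int[mu]_(x in D) f x - c * fine (mu D)| <= e * fine (mu D).
Proof.
move=> mD muD intf fc.
have intc r : mu.-integrable D (EFin \o cst r).
  apply/integrableP; split; first exact/measurable_EFinP.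
  by rewrite /= integral_cst// lte_mul_pinfty.
rewrite -!Rintegral_cst// -RintegralB//; last exact: intc.
have intB : mu.-integrable D (EFin \o (fun x => f x - c)).
  exact: (integrableB mD intf (intc c)).
apply: le_trans; first exact: le_normr_Rintegral.
apply: le_Rintegral => //; last exact: intc.
exact: (integrable_norm intB).
Qed.

Lemma bounded_fun_comp (X Y : Type) (R : realType) (f : X -> R)
    (h : Y -> X) :
  [bounded f x | x in setT] -> [bounded f (h y) | y in setT].
Proof. by case=> M [Mr bM]; exists M; split=> // N /bM H y _; exact: H. Qed.

Section charge_integral.
Context d (X : measurableType d) (R : realType).
Implicit Types m p n : {finite_measure set X -> \bar R}.

Lemma bounded_integrable m (f : X -> R) :
  measurable_fun setT f -> [bounded f x | x in setT] ->
  m.-integrable setT (EFin \o f).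
Proof.
by move=> mf bf; apply: measurable_bounded_integrable; rewrite ?fin_num_fun_lty.
Qed.

(* The measures [p + m2] and [m1 + n] agree. *)
Lemma eq_measure_diff_integral p n m1 m2 (f : X -> R) :
  measurable_fun setT f -> [bounded f x | x in setT] ->
  (forall A, measurable A -> p A - n A = m1 A - m2 A)%E ->
  (\int[p]_x (f x)%:E - \int[n]_x (f x)%:E =
   \int[m1]_x (f x)%:E - \int[m2]_x (f x)%:E)%E.
Proof.
move=> mf bf pnm.
have intf m := bounded_integrable m f mf bf.
have finf m : (\int[m]_x (f x)%:E)%E \is a fin_num.
  exact: integrable_fin_num (intf m).
have E : (\int[p]_x (f x)%:E + \int[m2]_x (f x)%:E =
          \int[m1]_x (f x)%:E + \int[n]_x (f x)%:E)%E.
  rewrite -!integral_measure_add//; try exact: intf; try exact/measurable_EFinP.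
  apply: eq_measure_integral => A mA _.
  rewrite /= /msum !big_ord_recr !big_ord0 /= !add0e.
  have := pnm A mA.
  rewrite -[p A]fineK ?fin_num_measure// -[n A]fineK ?fin_num_measure//.
  rewrite -[m1 A]fineK ?fin_num_measure// -[m2 A]fineK ?fin_num_measure//.
  by rewrite -!EFinN -!EFinD => -[?]; congr (_%:E); lra.
move: E; rewrite -[(\int[p]_x _)%E]fineK// -[(\int[n]_x _)%E]fineK//.
rewrite -[(\int[m1]_x _)%E]fineK// -[(\int[m2]_x _)%E]fineK//.
by rewrite -!EFinN -!EFinD => -[?]; congr (_%:E); lra.
Qed.

(** The Jordan parts p and n of the charge satisfy p - n = m1 - m2, whichever Hahn decomposition was
    chosen. *)
Lemma charge_integral_measure_diff m1 m2 (f : X -> R) :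
  measurable_fun setT f -> [bounded f x | x in setT] ->
  charge_integral (measure_diff m1 m2) f =
  (\int[m1]_x f x - \int[m2]_x f x)%:E.
Proof.
move=> mf bf; rewrite /charge_integral.
rewrite (eq_measure_diff_integral _ _ m1 m2)//; last first.
  move=> A mA; have := jordan_decomp (svalP (cid (svalP (cid
    (Hahn_decomposition (measure_diff m1 m2)))))) mA.
  by rewrite /cadd /= cscaleN1 => <-.
rewrite EFinB !fineK//; apply: integrable_fin_num => //;
  exact: bounded_integrable.
Qed.

End charge_integral.

(** * Riemann sums of a 1-periodic, 1-Lipschitz function *)

Section riemann_sums.
Variables (R : realType) (G : R -> R).
Hypothesis G_lip : forall x y, `|G x - G y| <= `|x - y|.
Hypothesis G_per : forall x, G (x + 1) = G x.

Lemma dist_le_continuous : continuous G.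
Proof.
move=> x; apply/cvgrPdist_le => e e0; near=> y.
apply: le_trans (G_lip _ _) _; near: y.
exact: cvgr_dist_le.
Unshelve. all: by end_near. Qed.

Let G_integrable (a b : R) :
  (@lebesgue_measure R).-integrable `[a, b[ (EFin \o G).
Proof.
have : (@lebesgue_measure R).-integrable `[a, b] (EFin \o G).
  apply: continuous_compact_integrable; first exact: segment_compact.
  by apply: continuous_subspaceT; exact: dist_le_continuous.
by apply: integrableS => //; apply: subset_itvl; rewrite bnd_simp.
Qed.

(** In the cell [j/K, (j+1)/K[ the sample point r + j/K is within 1/K of every t, because 0 <= r <=
    1/K; so each cell costs at most 1/K^2. The number n of cells is left free for the induction. *)
Let riemann_sum_itv (K n : nat) (r : R) : (0 < K)%N -> 0 <= r <= K%:R^-1 ->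
  `|\int[@lebesgue_measure R]_(t in `[0, n%:R / K%:R[) G t
     - K%:R^-1 * \sum_(i < n) G (r + i%:R / K%:R)| <=
  n%:R * (K%:R^-1 * K%:R^-1).
Proof.
move=> K0 /andP[r0 rK]; set h := K%:R^-1 in rK *.
have h0 : 0 < h by rewrite invr_gt0 ltr0n.
elim: n => [|n IH].
  by rewrite !mul0r set_itvco0 Rintegral_set0 big_ord0 mulr0 subr0 normr0.
have nh0 : 0 <= n%:R * h by rewrite mulr_ge0// ltW.
have -> : n.+1%:R * h = n%:R * h + h by rewrite -natr1; ring.
rewrite (@itv_bndbnd_setU _ _ _ (BLeft (n%:R * h))) ?bnd_simp//; last first.
  by rewrite lerDl ltW.
rewrite Rintegral_setU//; last first.
- apply/disj_setPS => y [/=]; rewrite 2!in_itv/= => /andP[_ yx] /andP[].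
  by rewrite leNgt yx.
- by rewrite -itv_bndbnd_setU ?bnd_simp// ?lerDl ?ltW.
have : `|\int[@lebesgue_measure R]_(t in `[n%:R * h, n%:R * h + h[) G t
          - G (r + n%:R * h) * h| <= h * h.
  have mh : fine ((@lebesgue_measure R) `[n%:R * h, n%:R * h + h[) = h.
    rewrite lebesgue_measure_itv /= lte_fin ltrDl h0 -EFinD.
    by rewrite addrAC subrr add0r.
  rewrite -[X in _ - _ * X]mh -[X in _ <= _ * X]mh.
  apply: Rintegral_dist_cst => //.
    by rewrite /= lebesgue_measure_itv /= lte_fin ltrDl h0 -EFinD ltry.
  move=> t /=; rewrite in_itv /= => /andP[t1 t2].
  by apply: le_trans (G_lip _ _) _; rewrite ler_norml; apply/andP; split; lra.
move: IH; rewrite big_ord_recr /= mulrDr -natr1 mulrDl mul1r.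
move: (\int[_]_(_ in _) _) (\int[_]_(_ in _) _) => I J.
rewrite !ler_norml => /andP[? ?] /andP[? ?]; apply/andP; split; lra.
Qed.

(** A shift by 1/K only moves the first sample to the end, one period later. This reduces any
    nonnegative offset to one in [0, 1/K]. *)
Let riemann_sum_shift (K n : nat) (r : R) : (0 < K)%N ->
  \sum_(i < K) G (r + n%:R / K%:R + i%:R / K%:R) =
  \sum_(i < K) G (r + i%:R / K%:R).
Proof.
move=> K0; have K0' : K%:R != 0 :> R by rewrite pnatr_eq0 -lt0n.
elim: n => [|n <-]; first by rewrite mul0r addr0.
case: K K0 K0' => // K _ K0'.
rewrite big_ord_recr [RHS]big_ord_recl /= addrC; congr (_ + _).
  rewrite mul0r addr0 -[RHS]G_per; congr G.
  by rewrite -(natr1 n); move: K0'; rewrite -(natr1 K) => K0'; field.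
apply: eq_bigr => i _; congr G.
by rewrite /bump /= add1n -(natr1 n) -(natr1 i); ring.
Qed.

Lemma riemann_sum_dist (K : nat) (x : R) : (0 < K)%N -> 0 <= x ->
  `|\int[@lebesgue_measure R]_(t in `[0, 1[) G t
     - K%:R^-1 * \sum_(i < K) G (x + i%:R / K%:R)| <= K%:R^-1.
Proof.
move=> K0 x0; have K0' : 0 < K%:R :> R by rewrite ltr0n.
(* With n the truncation of x K, the offset x - n/K lies in [0, 1/K[; then K cells of cost 1/K^2
   give the bound 1/K. *)
have /truncn_itv : 0 <= x * K%:R by rewrite mulr_ge0// ltW.
move: (Num.truncn _) => n.
rewrite -ler_pdivrMr// -ltr_pdivlMr// -natr1 mulrDl mul1r => /andP[n1 n2].
rewrite -(subrK (n%:R / K%:R) x) riemann_sum_shift//.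
have := @riemann_sum_itv K K (x - n%:R / K%:R) K0.
rewrite divff ?gt_eqF// mulrA mulfV ?gt_eqF// mul1r; apply.
by apply/andP; split; lra.
Qed.

End riemann_sums.

(** * Circle distance and 1-Lipschitz functions on the circle *)

Section circle_lipschitz.
Variable R : realType.
Implicit Types (x y s : circle R) (g : circle R -> R).

Lemma nearest_int_dist_le (r : R) (k : int) :
  nearest_int_dist r <= `|r - k%:~R|.
Proof. by apply: ge_inf; [exists 0 => _ [j _ <-] /= | exists k]. Qed.

Lemma circle_dist_to_circle_le (a b : R) (k : int) :
  circle_dist (to_circle a) (to_circle b) <= `|a - b - k%:~R|.
Proof. by rewrite circle_distE nearest_int_dist_le. Qed.

Lemma circle_dist_translate s x y :
  circle_dist (x + s) (y + s) = circle_dist x y.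
Proof. by rewrite /circle_dist opprD addrACA subrr addr0. Qed.

Lemma circle_dist_ge0 x y : 0 <= circle_dist x y.
Proof.
apply: lb_le_inf; first by exists `|repr (x - y) - 0%:~R|, 0.
by move=> _ [k _ <-].
Qed.

(** Choosing the floor as integer gives this crude constant, enough to bound Lipschitz functions and
    to absorb a slack in the Lipschitz constant. *)
Lemma circle_dist_le1 x y : circle_dist x y <= 1.
Proof.
apply: le_trans (nearest_int_dist_le _ (Num.floor (repr (x - y)))) _.
rewrite ger0_norm ?subr_ge0 ?floor_le// lerBlDl -intrD1.
exact/ltW/floorD1_gt.
Qed.

Lemma to_circle1 : to_circle (1 : R) = 0.
Proof.
rewrite -[RHS](subrr (to_circle 0)) -to_circleB subrr.
by apply/(eq_to_circle _ _).2; rewrite subr0.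
Qed.

Lemma to_circle_nonneg x : exists2 r : R, 0 <= r & to_circle r = x.
Proof.
exists (repr x - (Num.floor (repr x))%:~R); first by rewrite subr_ge0 floor_le.
rewrite -[RHS](reprK x); apply/(eq_to_circle _ _).2.
by rewrite addrAC subrr add0r rpredN intr_int.
Qed.

Definition lipschitz1 g := forall x y, `|g x - g y| <= circle_dist x y.

Lemma lipschitz1_translate g s :
  lipschitz1 g -> lipschitz1 (fun x => g (x + s)).
Proof. by move=> gl x y; rewrite -(circle_dist_translate s); exact: gl. Qed.

Lemma lipschitz1_lift g (a b : R) : lipschitz1 g ->
  `|g (to_circle a) - g (to_circle b)| <= `|a - b|.
Proof.
move=> gl; apply: le_trans (gl _ _) _.
by apply: le_trans (circle_dist_to_circle_le _ _ 0) _; rewrite subr0.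
Qed.

Lemma lipschitz1_bounded g : lipschitz1 g -> [bounded g x | x in setT].
Proof.
move=> gl; exists (`|g 0| + 1); split; first exact: num_real.
move=> M ltM x _ /=; apply/ltW/le_lt_trans/ltM.
rewrite -[g x](subrK (g 0)) addrC (le_trans (ler_normD _ _))// lerD2l.
exact: le_trans (gl _ _) (circle_dist_le1 _ _).
Qed.

(** A set is open in the quotient topology when its preimage in the line is open. Continuity of the
    lift therefore makes preimages of open intervals open, hence Borel. *)
Lemma lipschitz1_measurable g : lipschitz1 g -> measurable_fun setT g.
Proof.
move=> gl; apply: (measurability _ (RGenOpens.measurableE R)).
move=> _ [_ [a [b ->]] <-]; rewrite setTI; apply: sub_sigma_algebra.
have /continuousP := @dist_le_continuous R (g \o @to_circle R)
  (fun a b => lipschitz1_lift g a b gl).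
by move=> /(_ _ (interval_open _ _)); apply.
Qed.

Lemma lipschitz1_integrable (m : {finite_measure set (circle R) -> \bar R}) g :
  lipschitz1 g -> m.-integrable setT (EFin \o g).
Proof.
move=> gl; apply: bounded_integrable; first exact: lipschitz1_measurable.
exact: lipschitz1_bounded.
Qed.

End circle_lipschitz.

(** * Integrals against probability, invariant and restricted measures *)

Section probability_Rintegral.
Context d (X : measurableType d) (R : realType) (mu : probability X R).
Implicit Types f h : X -> R.

Lemma Rintegral_probability_dist_cst f (c e : R) :
  mu.-integrable setT (EFin \o f) -> (forall x, `|f x - c| <= e) ->
  `|\int[mu]_x f x - c| <= e.
Proof.
move=> intf fc; have := @Rintegral_dist_cst _ _ _ mu setT f c e measurableT.
rewrite /= probability_setT /= !mulr1 ltry; apply => //.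
Qed.

Lemma Rintegral_probability_dist f h (e : R) :
  mu.-integrable setT (EFin \o f) -> mu.-integrable setT (EFin \o h) ->
  (forall x, `|f x - h x| <= e) ->
  `|\int[mu]_x f x - \int[mu]_x h x| <= e.
Proof.
move=> intf inth fh; rewrite -RintegralB// -[X in `|X|]subr0.
apply: Rintegral_probability_dist_cst => [|x]; last by rewrite subr0.
exact: (integrableB measurableT intf inth).
Qed.

Lemma Rintegral_sum n (F : 'I_n -> X -> R) :
  (forall i, mu.-integrable setT (EFin \o F i)) ->
  mu.-integrable setT (EFin \o (fun x => \sum_(i < n) F i x)) /\
  \int[mu]_x (\sum_(i < n) F i x) = \sum_(i < n) \int[mu]_x F i x.
Proof.
elim: n F => [|n IH] F intF.
  split.
    have -> : (fun x => \sum_(i < 0) F i x) = cst 0.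
      by apply/funext => x; rewrite big_ord0.
    exact: integrable0.
  rewrite big_ord0; under eq_Rintegral do rewrite big_ord0.
  by rewrite Rintegral_cst// mul0r.
have [int1 eq1] := IH (fun i => F (widen_ord (leqnSn n) i)) (fun i => intF _).
have E : (fun x => \sum_(i < n.+1) F i x) =
    (fun x => \sum_(i < n) F (widen_ord (leqnSn n) i) x + F ord_max x).
  by apply/funext => x; rewrite big_ord_recr.
rewrite E; split; first exact: (integrableD measurableT int1 (intF _)).
by rewrite RintegralD// eq1 [RHS]big_ord_recr.
Qed.

(** Invariance says that the pushforward of [mu] by [T] is [mu]; the rest is change of variables. *)
Lemma Rintegral_invariant (T : X -> X) f : measurable_fun setT T ->
  invariant_measure T mu -> measurable_fun setT f ->
  [bounded f x | x in setT] ->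
  \int[mu]_x f (T x) = \int[mu]_x f x.
Proof.
move=> mT inv mf bf; congr fine.
rewrite -[RHS](@eq_measure_integral _ _ _ _ mu (pushforward mu T)); last first.
  by move=> A mA _; exact: inv.
rewrite integral_pushforward ?preimage_setT//; first exact/measurable_EFinP.
have -> : (fun x => (f x)%:E) \o T = EFin \o (f \o T) by [].
apply: bounded_integrable; first exact: measurableT_comp.
exact: (bounded_fun_comp _ _ _ f T bf).
Qed.

End probability_Rintegral.

(** The restricted measure is null off [D] and agrees with [mu] on measurable subsets of [D]. *)
Lemma integral_mrestr d (X : measurableType d) (R : realType)
    (mu : {measure set X -> \bar R}) (D : set X) (mD : measurable D)
    (f : X -> \bar R) :
  (mrestr mu mD).-integrable setT f ->
  (\int[mrestr mu mD]_x f x = \int[mu]_(x in D) f x)%E.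
Proof.
move=> intf.
rewrite (@negligible_integral _ _ _ (mrestr mu mD) setT (~` D))//.
- rewrite setTD setCK; apply: eq_measure_integral => A mA AD.
  by rewrite /= /mrestr setIidl.
- exact: measurableC.
- by rewrite /= /mrestr setICl measure0.
Qed.

(** * Lebesgue integral on the circle and equispaced averages *)

Section circle_integral.
Variable R : realType.
Implicit Types (g : circle R -> R) (mu : probability (circle R) R).

Lemma Rintegral_circle_lebesgue g : lipschitz1 R g ->
  \int[@circle_lebesgue R]_x g x =
  \int[@lebesgue_measure R]_(t in `[0, 1[) g (to_circle t).
Proof.
move=> gl; congr fine.
have mg := lipschitz1_measurable R g gl.
have intg : (mrestr (@lebesgue_measure R)
    (measurable_itv `[0%R, 1%R[)).-integrable
    setT (EFin \o (g \o @to_circle R)).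
  apply: measurable_bounded_integrable => //.
  - by rewrite /= /mrestr setTI lebesgue_measure_itv /= lte01 oppr0 adde0 ltry.
  - apply: (measurableT_comp mg); exact: measurable_to_circle.
  - exact: (bounded_fun_comp _ _ _ g _ (lipschitz1_bounded R g gl)).
rewrite integral_pushforward ?preimage_setT//.
- exact: integral_mrestr.
- exact: measurable_to_circle.
- exact/measurable_EFinP.
Qed.

(** Riemann sums of the lift, started at a nonnegative representative of x; the lift has period 1
    since 1 maps to 0. *)
Lemma circle_average_dist g (K : nat) (x : circle R) : lipschitz1 R g ->
  (0 < K)%N ->
  `|\int[@circle_lebesgue R]_x g x
     - K%:R^-1 * \sum_(i < K) g (x + to_circle (i%:R / K%:R))| <= K%:R^-1.
Proof.
move=> gl K0; have [r r0 <-] := to_circle_nonneg R x.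
rewrite Rintegral_circle_lebesgue//.
under eq_bigr do rewrite -to_circleD.
apply: (riemann_sum_dist R (g \o @to_circle R)) => // [a b|a].
  exact: lipschitz1_lift.
by rewrite /= to_circleD to_circle1 addr0.
Qed.

(** * Invariant measures of a map close to a rotation *)

Section almost_rotation.
Context (alpha : R) (d : R) (mu : probability (circle R) R).
Variable T : circle R -> circle R.
Hypotheses (mT : measurable_fun setT T) (inv : invariant_measure T mu).
Hypothesis close : forall x, circle_dist (rotation alpha x) (T x) <= d.

Let integrable_translate g s : lipschitz1 R g ->
  mu.-integrable setT (EFin \o (fun x => g (x + s))).
Proof.
by move=> ?; apply: lipschitz1_integrable; exact: lipschitz1_translate.
Qed.

(** By invariance the second integral is that of g (T x), which is pointwise within d of g (x +
    alpha). *)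
Lemma Rintegral_translate_alpha g : lipschitz1 R g ->
  `|\int[mu]_x g (x + to_circle alpha) - \int[mu]_x g x| <= d.
Proof.
move=> gl.
rewrite -(Rintegral_invariant _ _ _ _ T g)//;
  [|exact: lipschitz1_measurable|exact: lipschitz1_bounded].
apply: Rintegral_probability_dist => [||x]; first exact: integrable_translate.
  apply: bounded_integrable.
    by apply: measurableT_comp => //; exact: lipschitz1_measurable.
  exact: (bounded_fun_comp _ _ _ g T (lipschitz1_bounded R g gl)).
exact: le_trans (gl _ _) (close x).
Qed.

(** Translates of g are again 1-Lipschitz, so the previous bound can be iterated, each step costing
    d. *)
Lemma Rintegral_translate_mul_alpha g (n : nat) : lipschitz1 R g ->
  `|\int[mu]_x g (x + to_circle (n%:R * alpha)) - \int[mu]_x g x| <= n%:R * d.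
Proof.
move=> gl; elim: n => [|n IH].
  (* Writing 0 as 0 - 0 lets [to_circleB] show that its class vanishes. *)
  under eq_Rintegral do
    rewrite mul0r -(subrr 0) to_circleB subrr addr0.
  by rewrite subrr normr0 mul0r.
have := Rintegral_translate_alpha (fun x => g (x + to_circle (n%:R * alpha)))
  (lipschitz1_translate R g _ gl).
under eq_Rintegral do rewrite -addrA -to_circleD.
rewrite -natr1 !mulrDl !mul1r [alpha + _]addrC.
move: IH; rewrite !ler_norml => /andP[? ?] /andP[? ?]; apply/andP; split; lra.
Qed.

(** Replacing t by n alpha moves every point by at most eps on the circle; n steps of the rotation
    then cost n d. *)
Lemma Rintegral_translate_dist g (n : nat) (k : int) (t eps : R) :
  lipschitz1 R g -> `|t - n%:R * alpha - k%:~R| <= eps ->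
  `|\int[mu]_x g (x + to_circle t) - \int[mu]_x g x| <= eps + n%:R * d.
Proof.
move=> gl teps.
have H1 := Rintegral_translate_mul_alpha g n gl.
have : `|\int[mu]_x g (x + to_circle t)
         - \int[mu]_x g (x + to_circle (n%:R * alpha))| <= eps.
  apply: Rintegral_probability_dist => [||x]; try exact: integrable_translate.
  apply: le_trans (gl _ _) _.
  rewrite ![x + _]addrC circle_dist_translate.
  exact: le_trans (circle_dist_to_circle_le _ _ _ k) teps.
move: H1; rewrite !ler_norml => /andP[? ?] /andP[? ?]; apply/andP; split; lra.
Qed.

Lemma Rintegral_circle_lebesgue_dist g (K N : nat) (eps : R) :
  (0 < K)%N -> 0 <= d -> lipschitz1 R g ->
  (forall i : 'I_K, exists (n : nat) (k : int), (n <= N)%N /\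
     `|i%:R / K%:R - n%:R * alpha - k%:~R| <= eps) ->
  `|\int[@circle_lebesgue R]_x g x - \int[mu]_x g x| <=
  K%:R^-1 + (eps + N%:R * d).
Proof.
move=> K0 d0 gl dense.
have K0' : 0 < K%:R :> R by rewrite ltr0n.
have [intS eqS] := Rintegral_sum _ _ _ mu K
  (fun i x => g (x + to_circle (i%:R / K%:R)))
  (fun i => integrable_translate g _ gl).
(* The integral of [psi] is compared with the Lebesgue integral of g pointwise, and with the
   integral of g against [mu] term by term. *)
pose psi x := K%:R^-1 * \sum_(i < K) g (x + to_circle (i%:R / K%:R)).
have intpsi : mu.-integrable setT (EFin \o psi).
  exact: (integrableZl measurableT _ intS).
have psi_m : `|\int[mu]_x psi x - \int[@circle_lebesgue R]_x g x| <= K%:R^-1.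
  apply: Rintegral_probability_dist_cst => // x.
  by rewrite distrC; exact: circle_average_dist.
have psi_mu : `|\int[mu]_x psi x - \int[mu]_x g x| <= eps + N%:R * d.
  rewrite RintegralZl// eqS.
  (* The integral of g is written as the mean of K copies of itself, to be matched with the K
     translates. *)
  rewrite -[X in _ - X](mulKf (lt0r_neq0 K0')).
  have -> : K%:R * \int[mu]_x g x = \sum_(i < K) \int[mu]_x g x.
    by rewrite sumr_const card_ord mulr_natl.
  rewrite -mulrBr -sumrB normrM gtr0_norm ?invr_gt0// ler_pdivrMl//.
  apply: le_trans (ler_norm_sum _ _ _) _.
  have -> : K%:R * (eps + N%:R * d) = \sum_(i < K) (eps + N%:R * d).
    by rewrite sumr_const card_ord mulr_natl.
  apply: ler_sum => i _; have [n [k [nN nk]]] := dense i.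
  apply: le_trans (Rintegral_translate_dist _ n k _ eps gl nk) _.
  by rewrite lerD2l ler_wpM2r// ler_nat.
move: psi_m psi_mu.
rewrite !ler_norml => /andP[? ?] /andP[? ?]; apply/andP; split; lra.
Qed.

End almost_rotation.
End circle_integral.

(** * Bounding the Wasserstein-type norm *)

Section wnorm.
Variable R : realType.

(** Without assuming that the infimum is attained, take a constant L < 1 + e; as circle distances
    are at most 1, the slack costs at most e. *)
Lemma lip_le1_lipschitz1 (g : circle R -> R) : (lip g <= 1)%E -> lipschitz1 R g.
Proof.
move=> g1 x y; apply/ler_addgt0Pr => e e0.
have /ereal_inf_lt[_ [L [L0 gL] <-]] : (lip g < (1 + e)%:E)%E.
  by rewrite (le_lt_trans g1)// lte_fin ltrDl.
rewrite lte_fin => Le; apply: le_trans (gL x y) _.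
have := circle_dist_ge0 R x y; have := circle_dist_le1 R x y.
move: (circle_dist x y) => t t1 t0.
by apply: le_trans (ler_wpM2r t0 (ltW Le)) _; nra.
Qed.

(** The zero function is admissible, so the supremum is not over an empty set and cannot be -oo. *)
Lemma wnorm_ge0 (nu : {charge set (circle R) -> \bar R}) : (0 <= wnorm nu)%E.
Proof.
apply: (le_trans (abse_ge0 (charge_integral nu (cst 0)))).
apply: ereal_sup_ubound; exists (cst 0) => //; split.
- apply: (@le_trans _ _ 0%E); last exact: lee01.
  apply: ereal_inf_lbound; exists 0 => //; split=> // x y.
  by rewrite subrr normr0 mul0r.
- by apply: ge_ereal_sup => _ [x _ <-]; rewrite normr0 lee01.
Qed.

Lemma wnorm_measure_diff_le (m1 m2 : {finite_measure set (circle R) -> \bar R})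
    (e : R) :
  (forall g, lipschitz1 R g -> `|\int[m1]_x g x - \int[m2]_x g x| <= e) ->
  (wnorm (measure_diff m1 m2) <= e%:E)%E.
Proof.
move=> H; apply: ge_ereal_sup => _ [g [g1 _] <-].
have gl := lip_le1_lipschitz1 g g1.
rewrite charge_integral_measure_diff ?lee_fin; first exact: H.
  exact: lipschitz1_measurable.
exact: lipschitz1_bounded.
Qed.

End wnorm.

(** * Choice of the parameters and passage to the limit *)

Lemma irrational_multiples_uniformly_dense (R : realType) (alpha eps : R)
    (K : nat) : irrational alpha -> 0 < eps ->
  exists N : nat, forall i : 'I_K, exists (n : nat) (k : int), (n <= N)%N /\
     `|i%:R / K%:R - n%:R * alpha - k%:~R| <= eps.
Proof.
move=> irr eps0.
have /choice[n Hn] (i : 'I_K) : exists n : nat, exists k : int,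
    `|i%:R / K%:R - n%:R * alpha - k%:~R| < eps.
  exact: irrational_multiples_dense.
exists (\max_(i < K) n i) => i; have [k Hk] := Hn i.
by exists (n i), k; split; [exact: leq_bigmax|exact: ltW].
Qed.

Theorem theorem2 (R : realType) (alpha : R) (alpha_irr : irrational alpha)
  (dbar : R) (dbar_gt0 : 0 < dbar)
  (T : R -> circle R -> circle R)
  (T_borel : forall d, 0 <= d <= dbar -> measurable_fun [set: circle R] (T d))
  (T_close : forall d, 0 <= d <= dbar ->
    (ereal_sup (range (fun x => (circle_dist (rotation alpha x) (T d x))%:E))
       <= d%:E)%E)
  (mu : R -> probability (circle R) R)
  (mu_inv : forall d, 0 <= d <= dbar -> invariant_measure (T d) (mu d)) :
  wnorm (measure_diff (@circle_lebesgue R) (mu d)) @[d --> (0 : R)^'+] --> 0%E.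
Proof.
suff main (e : R) : 0 < e -> \forall d \near (0 : R)^'+,
    (wnorm (measure_diff (@circle_lebesgue R) (mu d)) <= e%:E)%E.
  have fin_wnorm d (r : R) :
      (wnorm (measure_diff (@circle_lebesgue R) (mu d)) <= r%:E)%E ->
      wnorm (measure_diff (@circle_lebesgue R) (mu d)) \is a fin_num.
    by move=> wr; rewrite ge0_fin_numE ?wnorm_ge0// (le_lt_trans wr) ?ltry.
  (* Convergence in the extended reals needs eventual finiteness, supplied by the bound with e =
     1. *)
  apply/fine_cvgP; split.
    by apply: filterS (main 1 ltr01) => d; exact: fin_wnorm.
  apply/cvgrPdist_le => e e0; apply: filterS (main e e0) => d wd.
  rewrite sub0r normrN /= ger0_norm ?fine_ge0 ?wnorm_ge0//.
  by rewrite -lee_fin fineK ?(fin_wnorm _ e).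
move=> e0.
have e3 : 0 < e / 3 by lra.
(* [K] depends on e only and [N] on [K], e and alpha; d is taken small last, so each of the three
   error terms is at most e/3. *)
pose K := (Num.truncn (e / 3)^-1).+1.
have K0 : 0 < K%:R :> R by rewrite ltr0n.
have Ke : K%:R^-1 < e / 3 by rewrite invf_plt ?posrE// truncnS_gt.
have [N HN] := irrational_multiples_uniformly_dense _ _ _ K alpha_irr e3.
near=> d.
have d0 : 0 < d by near: d; exact: nbhs_right_gt.
have d_itv : 0 <= d <= dbar.
  by rewrite ltW//=; near: d; exact: nbhs_right_le.
have Nd : N%:R * d <= e / 3.
  (* [N] may be 0, so the division is by [N.+1]. *)
  apply: (@le_trans _ _ (N.+1%:R * d)).
    by rewrite ler_wpM2r ?ler_nat ?ltW.
  rewrite mulrC -ler_pdivlMr ?ltr0n//; near: d; apply: nbhs_right_le.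
  by rewrite divr_gt0.
apply: wnorm_measure_diff_le => g gl.
apply: (@le_trans _ _ (K%:R^-1 + (e / 3 + N%:R * d))); last by lra.
apply: (Rintegral_circle_lebesgue_dist R alpha d (mu d) (T d)) => //.
- exact: T_borel.
- exact: mu_inv.
- move=> x; rewrite -lee_fin; apply: le_trans (T_close d d_itv).
  by apply: ereal_sup_ubound; exists x.
Unshelve. all: by end_near.
Qed.
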